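(* Let $A_1,\dots,A_n$ be finite subsets of $\mathbb{R}$, let $\nu_i:A_i\to\mathbb{N}$ ($i=1,\dots,n$) be functions with positive integer values, put $\mathbf{A}=A_1\times\cdots\times A_n$, and let $t_{\mathbf{a}}^{\mathbf{m}}\in\mathbb{R}$ be given for $\mathbf{a}\in\mathbf{A}$, $\mathbf{m}\in[\mathbf{0},\nu(\mathbf{a})-\mathbf{1}]$. Let $k\in\{1,\dots,n\}$ and $a\in A_k$, and put $\mathbf{A}_{a-}^k:=\{\mathbf{a}\in\mathbf{A}:a_k\le a\}$ and $\mathbf{A}_{a+}^k:=\{\mathbf{a}\in\mathbf{A}:a_k\ge a\}$. Let $p_{a-}^k\in V(\mathbf{A}_{a-}^k,\nu)$ and $p_{a+}^k\in V(\mathbf{A}_{a+}^k,\nu)$ be the unique polynomials in these spaces such that $$\partial_{\mathbf{a}}^{\mathbf{m}}p_{a-}^k=t_{\mathbf{a}}^{\mathbf{m}}\quad(\mathbf{a}\in\mathbf{A}_{a-}^k,\ \mathbf{m}\in[\mathbf{0},\nu(\mathbf{a})-\mathbf{1}]),\qquad\partial_{\mathbf{a}}^{\mathbf{m}}p_{a+}^k=t_{\mathbf{a}}^{\mathbf{m}}\quad(\mathbf{a}\in\mathbf{A}_{a+}^k,\ \mathbf{m}\in[\mathbf{0},\nu(\mathbf{a})-\mathbf{1}]).$$ Then the piecewise function $$\mathbf{x}\mapsto\begin{cases}p_{a-}^k(\mathbf{x}),&x_k\le a,\\ p_{a+}^k(\mathbf{x}),&x_k\ge a,\end{cases}\qquad\mathbf{x}\in\mathbb{R}^n,$$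 is well defined and continuous at every $\mathbf{x}$ with $x_k=a$.
   Context: For $\mathbf{a}=(a_1,\dots,a_n)\in\mathbf{A}$, $\nu(\mathbf{a}):=(\nu_1(a_1),\dots,\nu_n(a_n))$, and $[\mathbf{0},\nu(\mathbf{a})-\mathbf{1}]$ is the set of $\mathbf{m}=(m_1,\dots,m_n)$ with integers $0\le m_i\le\nu_i(a_i)-1$. $\partial_{\mathbf{a}}^{\mathbf{m}}p$ is the value at $\mathbf{x}=\mathbf{a}$ of $\frac{\partial^{m_1+\cdots+m_n}p}{\partial x_1^{m_1}\cdots\partial x_n^{m_n}}$. For a grid $\mathbf{B}=B_1\times\cdots\times B_n$ with $B_i\subseteq A_i$, $V(\mathbf{B},\nu)$ is the real vector space of all $f\in\mathbb{R}[x_1,\dots,x_n]$ with $\deg_i f<\sum_{b\in B_i}\nu_i(b)$ for $i=1,\dots,n$ ($\deg_i$ is the degree in $x_i$; zero polynomial included). The sets $\mathbf{A}_{a-}^k$ and $\mathbf{A}_{a+}^k$ are such grids: they are obtained from $\mathbf{A}$ by replacing $A_k$ with $\{c\in A_k:c\le a\}$ and $\{c\in A_k:c\ge a\}$ respectively. It is a fact that on each grid the stated interpolation conditions determine a unique polynomial in the corresponding space. *)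

(* Defs.v *)
From HB Require Import structures.
From mathcomp Require Import all_boot all_order all_algebra finmap.
(* mpoly has to be imported before MathComp-Analysis: in the other order the
   levels of their notations clash. *)
From mathcomp Require Import mpoly.
From mathcomp Require Import all_classical all_reals topology normedtype.

Set Implicit Arguments.
Unset Strict Implicit.
Unset Printing Implicit Defensive.

Import Order.TTheory GRing.Theory Num.Theory.
Import numFieldNormedType.Exports.

Local Open Scope classical_set_scope.
Local Open Scope ring_scope.

Section HermiteGrid.
Variables (R : realType) (n : nat).
Implicit Types (A B : 'I_n -> {fset R}) (nu : 'I_n -> R -> nat).
Implicit Types (p q : {mpoly R[n]}) (k : 'I_n) (a : R).

Definition grid A : set 'rV[R]_n := [set x | forall i, x 0 i \in A i].

Definition restrict_le A k a : 'I_n -> {fset R} :=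
  fun i => if i == k then [fset c in A i | c <= a]%fset else A i.

Definition restrict_ge A k a : 'I_n -> {fset R} :=
  fun i => if i == k then [fset c in A i | a <= c]%fset else A i.

Lemma grid_restrict_le A k a :
  grid (restrict_le A k a) = grid A `&` [set x | x 0 k <= a].
Proof.
apply/seteqP; split=> x /=.
  move=> gx; split=> [i|].
    by have := gx i; rewrite /restrict_le; case: eqP => // _; rewrite !inE => /andP[].
  by have := gx k; rewrite /restrict_le eqxx !inE => /andP[].
case=> gx xk i; rewrite /restrict_le; case: eqP => [->|_]; last exact: gx.
by rewrite !inE gx.
Qed.

Lemma grid_restrict_ge A k a :
  grid (restrict_ge A k a) = grid A `&` [set x | a <= x 0 k].
Proof.
apply/seteqP; split=> x /=.
  move=> gx; split=> [i|].
    by have := gx i; rewrite /restrict_ge; case: eqP => // _; rewrite !inE => /andP[].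
  by have := gx k; rewrite /restrict_ge eqxx !inE => /andP[].
case=> gx xk i; rewrite /restrict_ge; case: eqP => [->|_]; last exact: gx.
by rewrite !inE gx.
Qed.

(* Equal to 0 on the zero polynomial, which [interp_space] handles apart. *)
Definition degi (i : 'I_n) p : nat := (\max_(m <- msupp p) m i)%N.

Definition interp_space B nu : set {mpoly R[n]} :=
  [set p | p = 0 \/ forall i, (degi i p < \sum_(b <- B i) nu i b)%N].

Definition interpolates B nu (t : 'rV[R]_n -> 'X_{1..n} -> R) p : Prop :=
  forall b, grid B b ->
  forall m : 'X_{1..n}, (forall i, (m i < nu i (b 0%R i))%N) ->
  p^`M[m].@[b 0] = t b m.

Definition piecewise k a p q (x : 'rV[R]_n) : R :=
  if x 0 k <= a then p.@[x 0] else q.@[x 0].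

End HermiteGrid.

(* Main.v *)
Require Import Defs.
From HB Require Import structures.
From mathcomp Require Import all_boot all_order all_algebra finmap.
From mathcomp Require Import mpoly.
From mathcomp Require Import all_classical all_reals topology normedtype.

Import Order.TTheory GRing.Theory Num.Theory.
Import numFieldNormedType.Exports.

Local Open Scope classical_set_scope.
Local Open Scope ring_scope.

(* On the hyperplane x_k = a, the difference pm - pp and all its derivatives
   not involving x_k vanish, up to the prescribed orders, on the grid obtained
   from A by replacing A_k with {a}, and its degree in each x_i with i != k is
   less than the number of conditions along the i-th axis.  By univariate
   Hermite uniqueness, applied to one variable x_i with i != k after the other,
   the difference vanishes on the whole hyperplane. *)

(** Taylor expansion at [b]: the terms of index below [N] vanish, and the others carry the factor
    [('X - b%:P) ^+ N]. *)
Lemma dvdp_exp_XsubC_nderivn (K : fieldType) (p : {poly K}) (b : K) (N : nat) :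
  (forall j, (j < N)%N -> p^`N(j).[b] = 0) -> ('X - b%:P) ^+ N %| p.
Proof.
(* Over the coefficient ring [{poly K}], [p] is its own value at ['X = b%:P + ('X - b%:P)], a form
   that [nderiv_taylor] expands. *)
move=> pb0; rewrite -[p]comp_polyXr /comp_poly -[X in _.[X]](subrKC b%:P).
rewrite nderiv_taylor; last exact: mulrC.
elim/big_ind: _ => [|q r dvdq dvdr|i _]; [exact: dvdp0|exact: dvdp_add|].
rewrite nderivn_map -/(comp_poly _ _) comp_polyCr.
have [iN|Ni] := ltnP i N; first by rewrite pb0 // mul0r dvdp0.
by rewrite dvdp_mull // dvdp_exp2l.
Qed.

Lemma coprimep_prodr (K : fieldType) (I : eqType) (s : seq I)
    (F : I -> {poly K}) (p : {poly K}) :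
  (forall i, i \in s -> coprimep p (F i)) -> coprimep p (\prod_(i <- s) F i).
Proof.
move=> cpF; rewrite big_seq.
elim/big_ind: _ => [|q r cpq cpr|//]; first exact: coprimep1.
by rewrite coprimepMr cpq.
Qed.

(** The powers [('X - b%:P) ^+ nu b] are pairwise coprime divisors of [p], so their product divides
    [p]; its degree, the sum of the [nu b], is too large for a nonzero [p]. *)
Lemma hermite_poly_eq0 (K : numFieldType) (s : seq K) (nu : K -> nat)
    (p : {poly K}) :
  uniq s -> (forall b j, b \in s -> (j < nu b)%N -> p^`(j).[b] = 0) ->
  (size p <= \sum_(b <- s) nu b)%N -> p = 0.
Proof.
move=> us pb0 sp.
pose F (b : K) : {poly K} := ('X - b%:P) ^+ nu b.
have dvdF : \prod_(b <- s) F b %| p.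
  elim: s us pb0 {sp} => [|b s IHs] /=; first by rewrite big_nil dvd1p.
  move=> /andP[bs us] pb0; rewrite big_cons Gauss_dvdp; last first.
    apply: coprimep_prodr => c cs; apply/coprimep_expl/coprimep_expr.
    by apply: coprimep_XsubC2; rewrite subr_eq0; apply: contraNneq bs => <-.
  apply/andP; split; last first.
    by apply: IHs => // c j cs; apply: pb0; rewrite inE cs orbT.
  apply: dvdp_exp_XsubC_nderivn => j jb.
  (* The [j]-th derivative is j! times the normalised one, and j! is nonzero in characteristic 0. *)
  have := pb0 b j (mem_head _ _) jb; rewrite nderivn_def hornerMn => /eqP.
  by rewrite mulrn_eq0 eqn0Ngt fact_gt0 => /eqP.
apply/eqP; apply: contraLR dvdF => p0; apply/negP => /(dvdp_leq p0).
apply/negP; rewrite -ltnNge (leq_trans _ (_ : (\sum_(b <- s) nu b).+1 <= _)%N) //.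
rewrite size_prod_seq => [|b _]; last by rewrite expf_neq0 // polyXsubC_eq0.
under [X in (_ <= X.+1 - _)%N]eq_bigr => b _ do rewrite size_exp_XsubC -addn1.
by rewrite big_split /= sum1_size -addSn addnK.
Qed.

Definition with_coord {K : Type} {n : nat} (i : 'I_n) (v : 'I_n -> K) (c : K) :
  'I_n -> K := fun l => if l == i then c else v l.

(** The restriction of [p] to the line through [v] parallel to the [i]-th axis, parametrised by the
    [i]-th coordinate. *)
Definition mline {K : comNzRingType} {n : nat} (i : 'I_n) (v : 'I_n -> K)
    (p : {mpoly K[n]}) : {poly K} :=
  mmap polyC (with_coord i (fun l => (v l)%:P) 'X) p.

Section Mline.
Variables (K : comNzRingType) (n : nat) (i : 'I_n) (v : 'I_n -> K).
Implicit Type p : {mpoly K[n]}.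

Lemma mmap1_mline (m : 'X_{1..n}) :
  mmap1 (with_coord i (fun l => (v l)%:P) 'X) m =
  'X^(m i) * (\prod_(l | l != i) v l ^+ m l)%:P.
Proof.
rewrite /mmap1 (bigD1 i) //= /with_coord eqxx rmorph_prod; congr (_ * _).
by apply: eq_bigr => l /negPf ->; rewrite rmorphXn.
Qed.

Lemma horner_mline p c : (mline i v p).[c] = p.@[with_coord i v c].
Proof.
rewrite /mline /mmap horner_sum mevalE; apply: eq_bigr => m _.
rewrite mmap1_mline !hornerE [in RHS](bigD1 i) //= /with_coord eqxx.
by rewrite -mulrA; congr (_ * (_ * _)); apply: eq_bigr => l /negPf ->.
Qed.

Lemma deriv_mline p : (mline i v p)^`() = mline i v p^`M(i).
Proof.
rewrite /mline [p in RHS]mpolyE (raddf_sum (mderiv i)) /= raddf_sum /=.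
rewrite [RHS]raddf_sum /=; apply: eq_bigr => m _.
rewrite mderivZ mderivX !mmapZ mmapX !mmap1_mline.
rewrite mul_polyC derivZ -mul_polyC derivM derivC mulr0 addr0 derivXn.
rewrite mnmBE mnm1E eqxx subn1 rmorph_nat -mulr_natl -mulrA; congr (_ * (_ * (_ * _%:P))).
by apply: eq_bigr => l /negPf li; rewrite mnmBE mnm1E eq_sym li subn0.
Qed.

Lemma derivn_mline p j : (mline i v p)^`(j) = mline i v p^`M(i, j).
Proof.
by elim: j => [|j IHj]; rewrite ?mderivn0 // derivnS IHj deriv_mline -mderivnS.
Qed.

Lemma size_mline p N :
  (forall m, m \in msupp p -> (m i < N)%N) -> (size (mline i v p) <= N)%N.
Proof.
move=> pN; rewrite /mline /mmap big_seq; apply: (leq_trans (size_sum _ _ _)).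
apply/bigmax_leqP_seq => m _ /pN; apply: leq_trans.
rewrite mmap1_mline mulrCA -polyCM mulrC mul_polyC.
by apply: leq_trans (size_scale_leq _ _) _; rewrite size_polyXn.
Qed.

End Mline.

(** A monomial [m'] of the derivative comes from the monomial [m + m'] of [p]. Hence the degree
    bounds in [hermite_vanish] pass to the derivatives it restricts to lines. *)
Lemma msupp_mderivm_lt (K : nzRingType) (n : nat) (i : 'I_n) (p : {mpoly K[n]})
    (m : 'X_{1..n}) (N : nat) :
  (forall m', m' \in msupp p -> (m' i < N)%N) ->
  forall m', m' \in msupp p^`M[m] -> (m' i < N)%N.
Proof.
move=> pN m'; rewrite mcoeff_msupp mcoeff_mderivm => cp.
have /pN : (m + m')%MM \in msupp p.
  by rewrite mcoeff_msupp; apply: contra_neq cp => ->; rewrite mul0rn.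
by apply: leq_ltn_trans; rewrite mnmDE leq_addl.
Qed.

(* The list [s] collects the coordinates already freed from the grid: freeing
   coordinate [i] applies univariate Hermite uniqueness on a line parallel to
   the [i]-th axis. *)
Lemma hermite_vanish (K : numFieldType) (n : nat) (B : 'I_n -> seq K)
    (nu : 'I_n -> K -> nat) (p : {mpoly K[n]}) (s : seq 'I_n) :
  (forall i, uniq (B i)) ->
  (forall i, i \in s ->
     forall m, m \in msupp p -> (m i < \sum_(b <- B i) nu i b)%N) ->
  (forall v, (forall i, v i \in B i) ->
     forall m : 'X_{1..n}, (forall i, (m i < nu i (v i))%N) ->
     p^`M[m].@[v] = 0) ->
  forall v (m : 'X_{1..n}),
    (forall i, i \notin s -> v i \in B i /\ (m i < nu i (v i))%N) ->
    (forall i, i \in s -> m i = 0%N) -> p^`M[m].@[v] = 0.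
Proof.
move=> uB + p0; elim: s => [|i s IHs] degp v m vm ms.
  by apply: p0 => i; case: (vm i).
have {}IHs := IHs (fun l ls => degp l (@mem_behead _ (i :: s) l ls)).
(* A repeated [i] is already free, so the induction hypothesis applies directly. *)
have [si|si] := boolP (i \in s).
  apply: IHs => [l ls|l ls]; last by apply: ms; rewrite inE ls orbT.
  by apply: vm; rewrite inE negb_or ls andbT; apply: contraNneq ls => ->.
suff g0 : mline i v p^`M[m] = 0.
  have := horner_mline _ _ i v p^`M[m] (v i); rewrite g0 horner0 => ->.
  by apply: meval_eq => l; rewrite /with_coord; case: eqP => [->|].
apply: (@hermite_poly_eq0 _ (B i) (nu i)) => // [b j bB jb|]; last first.
  by apply/size_mline/msupp_mderivm_lt/degp/mem_head.
(* Differentiating [j] times along the line raises the [i]-th order from 0 to [j], and the point now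
   has [i]-th coordinate [b] in [B i]: this meets the condition at [i] in the induction hypothesis,
   where [i] is not yet free. *)
rewrite derivn_mline horner_mline -mderivmDm.
apply: IHs => l ls; rewrite mnmDE mulmnE mnm1E.
  rewrite /with_coord [i == l]eq_sym; have [->|li] := eqVneq l i.
    by rewrite ms ?mem_head // mul1n.
  by rewrite mul0n addn0; apply: vm; rewrite inE negb_or li.
have /negPf-> : i != l by apply: contraNneq si => ->.
by rewrite ms // inE ls orbT.
Qed.

Lemma meval_continuous (R : realType) (n : nat) (p : {mpoly R[n]}) :
  continuous (fun x : 'rV[R]_n => p.@[x 0]).
Proof.
move=> x; under eq_fun do rewrite mevalE.
have := nbhs_filter x; rewrite /continuous_at; set F := nbhs x => Fx.
apply: (@cvg_big _ _ _ _ _ _ _ F) => [|m _]; first exact: add_continuous.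
apply: cvgM; first exact: cvg_cst.
apply: (@cvg_big _ _ _ _ _ _ _ F) => [|i _]; first exact: mul_continuous.
elim: (m i) => [|j IHj]; first by under eq_fun do rewrite expr0; exact: cvg_cst.
under eq_fun do rewrite exprS; rewrite exprS.
by apply: cvgM => //; exact: coord_continuous.
Qed.

(** Both polynomials tend to the common value at [x], and the piecewise function agrees at each
    point with one of them. *)
Lemma continuous_piecewise (R : realType) (n : nat) (k : 'I_n) (a : R)
    (p q : {mpoly R[n]}) (x : 'rV[R]_n) :
  p.@[x 0] = q.@[x 0] -> {for x, continuous (piecewise k a p q)}.
Proof.
move=> pq.
have fx : piecewise k a p q x = p.@[x 0] by rewrite /piecewise -pq if_same.
move=> U; have -> : nbhs (piecewise k a p q x) U = nbhs p.@[x 0] U by rewrite fx.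
move=> Up; have Uq := Up; rewrite pq in Uq.
apply: (@filterS2 _ (nbhs x) (nbhs_filter x) _ _ _ _
  (meval_continuous _ _ p x U Up) (meval_continuous _ _ q x U Uq)).
by move=> y py qy; rewrite /= /piecewise; case: ifP.
Qed.

Lemma interp_space_msupp_lt (R : realType) (n : nat) (B : 'I_n -> {fset R})
    (nu : 'I_n -> R -> nat) (p : {mpoly R[n]}) :
  interp_space B nu p -> forall i (m : 'X_{1..n}), m \in msupp p ->
  (m i < \sum_(b <- B i) nu i b)%N.
Proof.
case=> [->|degp] i m; first by rewrite msupp0.
by move=> mp; apply: leq_ltn_trans (degp i); exact: leq_bigmax_seq.
Qed.

Theorem theorem6p1 (R : realType) (n : nat)
    (A : 'I_n -> {fset R}) (nu : 'I_n -> R -> nat)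
    (nu_gt0 : forall (i : 'I_n) (b : R), b \in A i -> (0 < nu i b)%N)
    (t : 'rV[R]_n -> 'X_{1..n} -> R)
    (k : 'I_n) (a : R) (aA : a \in A k)
    (pm pp : {mpoly R[n]})
    (pmV : interp_space (restrict_le A k a) nu pm)
    (pmt : interpolates (restrict_le A k a) nu t pm)
    (ppV : interp_space (restrict_ge A k a) nu pp)
    (ppt : interpolates (restrict_ge A k a) nu t pp) :
  (forall x : 'rV[R]_n, x 0 k = a -> pm.@[x 0] = pp.@[x 0]) /\
  (forall x : 'rV[R]_n, x 0 k = a ->
     {for x, continuous (piecewise k a pm pp)}).
Proof.
suff eq_a : forall x : 'rV[R]_n, x 0 k = a -> pm.@[x 0] = pp.@[x 0].
  by split=> // x /eq_a; apply: continuous_piecewise.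
move=> x xk; apply/eqP; rewrite -subr_eq0 -mevalB -[pm - pp]mderivm0m; apply/eqP.
(* This grid lies in both half grids, so [pm] and [pp] share the data [t] on it. *)
pose B i : seq R := if i == k then [:: a] else A i.
(* All coordinates but [k] are freed. With the zero multi-index, the order condition left at [k] is
   [0 < nu k a]. *)
apply: (@hermite_vanish _ _ B nu _ (rem k (enum 'I_n))) => [i|i|v vB m mB|i|i _].
- by rewrite /B; case: eqP => // _; exact: fset_uniq.
(* For [i != k] both half grids have the factor [A i], so [pm] and [pp] obey the same degree bound
   and their difference inherits it. *)
- rewrite mem_rem_uniq ?enum_uniq // inE => /andP[/negPf ik _] m /msuppB_le.
  rewrite mem_cat /B ik => /orP[mpm|mpp].
    by have := interp_space_msupp_lt _ _ _ _ _ pmV i m mpm; rewrite /restrict_le ik.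
  by have := interp_space_msupp_lt _ _ _ _ _ ppV i m mpp; rewrite /restrict_ge ik.
- pose b : 'rV[R]_n := \row_i v i.
  have bv : b 0 =1 v by move=> i; rewrite mxE.
  have mb i : (m i < nu i (b 0%R i))%N by rewrite bv.
  have gle : grid (restrict_le A k a) b.
    move=> i; rewrite bv /restrict_le; have := vB i; rewrite /B.
    by case: eqP => // ->; rewrite !inE => /eqP ->; rewrite aA lexx.
  have gge : grid (restrict_ge A k a) b.
    move=> i; rewrite bv /restrict_ge; have := vB i; rewrite /B.
    by case: eqP => // ->; rewrite !inE => /eqP ->; rewrite aA lexx.
  rewrite -(meval_eq _ bv) mderivmB mevalB.
  by rewrite (pmt _ gle _ mb) (ppt _ gge _ mb) subrr.
- rewrite mem_rem_uniq ?enum_uniq // inE mem_enum andbT negbK => /eqP ->.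
  by split; [rewrite /B eqxx inE xk | rewrite xk mnm0E nu_gt0].
- exact: mnm0E.
Qed.
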